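(* Let $m\in(0,1)$ be fixed and let $K=ABCD$ be an arbitrary convex quadrilateral in the plane. Let $M$, $N$, $P$, $Q$ be the points on the sides $AB$, $BC$, $CD$, $DA$ respectively such that $AM:MB=BN:NC=CP:PD=DQ:QA=m:(1-m)$, and let $K'=MNPQ$. Then $$\frac{\Delta(K')}{\Delta(K)}=1-2m(1-m).$$
   Context: $\Delta(\cdot)$ denotes the area of a polygon. The vertices $A,B,C,D$ are listed in cyclic order along the boundary of $K$, and convex polygons are nondegenerate (any three consecutive vertices form a triangle of positive area). The quadrilateral $K'$ is called the first $m$-Kasner descendant of $K$. The condition $AM:MB=m:(1-m)$ means that $M$ lies on segment $AB$ with $\overrightarrow{AM}=m\,\overrightarrow{AB}$, and similarly for the other points. *)

(* Defs.v *)
From mathcomp Require Import all_boot all_order all_algebra.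
From mathcomp Require Import all_classical all_reals all_analysis.
From mathcomp Require Import ring lra.
Set Implicit Arguments.
Unset Strict Implicit.
Unset Printing Implicit Defensive.
Import Order.TTheory GRing.Theory Num.Theory.
Import numFieldNormedType.Exports.
Local Open Scope classical_set_scope.
Local Open Scope ring_scope.

Definition det2 (R : realType) (u v : R * R) : R := u.1 * v.2 - u.2 * v.1.

(* X and Y lie strictly on the same side of the line AB; in particular
   A, B, X are not collinear, and neither are A, B, Y. *)
Definition same_side (R : realType) (A B X Y : R * R) : Prop :=
  0 < det2 (B - A) (X - A) * det2 (B - A) (Y - A).

(* The vertices are listed in cyclic order; for every side, the two remaining
   vertices lie strictly on one side of the line carrying it.  Hence any three
   vertices form a triangle of positive area. *)
Definition convex_quadrilateral (R : realType) (A B C D : R * R) : Prop :=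
  [/\ same_side A B C D, same_side B C D A,
      same_side C D A B & same_side D A B C].

Definition convex_hull (R : realType) (X : set (R * R)) : set (R * R) :=
  smallest (@convex_set R (R * R)%type) X.

(* The planar region ABCD, for A, B, C, D the vertices of a convex
   quadrilateral. *)
Definition quadrilateral (R : realType) (A B C D : R * R) : set (R * R) :=
  convex_hull [set A; B; C; D].

Definition area (R : realType) (X : set (R * R)) : R :=
  fine ((lebesgue_measure \x lebesgue_measure)%E X).

(* For 0 < m < 1: M lies on the segment AB and AM : MB = m : (1 - m). *)
Definition divides_segment (R : realType) (m : R) (A B M : R * R) : Prop :=
  M - A = m *: (B - A).

Lemma convex_quadrilateralP (R : realType) (A B C D : R * R) :
  let x := det2 (B - A) (C - A) in let y := det2 (C - B) (D - B) in
  let z := det2 (D - C) (A - C) in let w := det2 (A - D) (B - D) in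
  convex_quadrilateral A B C D <->
  [/\ 0 < x, 0 < y, 0 < z & 0 < w] \/ [/\ x < 0, y < 0, z < 0 & w < 0].
Proof.
move=> x y z w.
have hw : det2 (B - A) (D - A) = w by rewrite /w /det2 /=; ring.
have hx : det2 (C - B) (A - B) = x by rewrite /x /det2 /=; ring.
have hy : det2 (D - C) (B - C) = y by rewrite /y /det2 /=; ring.
have hz : det2 (A - D) (C - D) = z by rewrite /z /det2 /=; ring.
rewrite /convex_quadrilateral /same_side hw hx hy hz -/x -/y -/z -/w.
split=> [[xw yx zy wz]|[[x0 y0 z0 w0]|[x0 y0 z0 w0]]]; last 2 first.
- by split; rewrite mulr_gt0.
- by split; rewrite nmulr_rgt0.
have [x0|x0|x0] := ltgtP x 0; last by rewrite x0 mul0r ltxx in xw.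
- right; have w0 : w < 0 by rewrite nmulr_rgt0 in xw.
  have z0 : z < 0 by rewrite nmulr_rgt0 in wz.
  by have y0 : y < 0 by rewrite nmulr_rgt0 in zy.
- left; have w0 : 0 < w by rewrite pmulr_rgt0 in xw.
  have z0 : 0 < z by rewrite pmulr_rgt0 in wz.
  by have y0 : 0 < y by rewrite pmulr_rgt0 in zy.
Qed.

(* The first m-Kasner descendant is again a convex quadrilateral, so that its
   region is indeed the convex hull of its vertices. *)
Lemma kasner_convex (R : realType) (m : R) (A B C D M N P Q : R * R) :
  0 < m < 1 -> convex_quadrilateral A B C D ->
  divides_segment m A B M -> divides_segment m B C N ->
  divides_segment m C D P -> divides_segment m D A Q ->
  convex_quadrilateral M N P Q.
Proof.
move=> /andP[m0 m1] K; rewrite /divides_segment.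
move=> /eqP; rewrite subr_eq => /eqP ->.
move=> /eqP; rewrite subr_eq => /eqP ->.
move=> /eqP; rewrite subr_eq => /eqP ->.
move=> /eqP; rewrite subr_eq => /eqP ->.
have n0 : 0 < 1 - m by rewrite subr_gt0.
have detE (A' B' C' D' : R * R) :
    det2 (m *: (C' - B') + B' - (m *: (B' - A') + A'))
         (m *: (D' - C') + C' - (m *: (B' - A') + A')) =
    (1 - m) ^+ 3 * det2 (B' - A') (C' - A') +
    (1 - m) ^+ 2 * m * det2 (A' - D') (B' - D') +
    (1 - m) * m ^+ 2 * det2 (D' - C') (A' - C') +
    m ^+ 3 * det2 (C' - B') (D' - B').
  case: A' B' C' D' => [a1 a2] [b1 b2] [c1 c2] [d1 d2].
  by rewrite /det2 /=; rewrite /GRing.scale /=; ring.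
have c1 : 0 < (1 - m) ^+ 3 by rewrite exprn_gt0.
have c2 : 0 < (1 - m) ^+ 2 * m by rewrite mulr_gt0 ?exprn_gt0.
have c3 : 0 < (1 - m) * m ^+ 2 by rewrite mulr_gt0 ?exprn_gt0.
have c4 : 0 < m ^+ 3 by rewrite exprn_gt0.
apply/convex_quadrilateralP; rewrite !detE.
have /convex_quadrilateralP[[x0 y0 z0 w0]|[x0 y0 z0 w0]] := K.
- by left; split; rewrite !addr_gt0 // mulr_gt0.
- by right; split; rewrite -oppr_gt0 !opprD !addr_gt0 // oppr_gt0 pmulr_rlt0.
Qed.

(* Main.v *)
(* The area of a convex quadrilateral ABCD is |det (C - A, D - B)| / 2, and the
   vectors P - M, Q - N are obtained from u = C - A, v = D - B by the matrix
   [[1 - m, m], [- m, 1 - m]], of determinant m^2 + (1 - m)^2 = 1 - 2m(1 - m).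

   For the area formula, planar Lebesgue measure is multiplied by |det| under
   affine maps: up to a swap of coordinates, such a map is a product of shears
   (x, y) |-> (x, s y + r x + f), whose effect is read on vertical sections.
   The standard triangle has measure 1/2, since a point reflection maps it onto
   the other half of the unit square.  A convex quadrilateral is the union of
   two triangles that overlap in a null set. *)
Require Import Defs.
From mathcomp Require Import all_boot all_order all_algebra.
From mathcomp Require Import all_classical all_reals all_analysis.
From mathcomp Require Import measurable_realfun ring lra.
Import Order.TTheory GRing.Theory Num.Theory.
Import numFieldNormedType.Exports.
Local Open Scope classical_set_scope.
Local Open Scope ring_scope.

Local Notation leb2 := (lebesgue_measure \x lebesgue_measure)%E.

(** * Lebesgue measure under affine maps, on the line and in the plane *)

(** The right-hand side is a measure in [X], so by uniqueness it suffices to compare on half-open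
    intervals; for [a < 0] the preimage is closed at the other end. *)
Lemma lebesgue_measure_affine {R : realType} (a b : R) (X : set R) :
  a != 0 -> measurable X ->
  (lebesgue_measure X =
   `|a|%:E * lebesgue_measure ((fun y => (a * y + b)%R) @^-1` X))%E.
Proof.
move=> a0 mX.
pose g : measurableTypeR R -> measurableTypeR R := fun y => a * y + b.
have mg : measurable_fun setT g.
  by apply: measurable_funD => //; apply: measurable_funM.
pose nu : {measure set (measurableTypeR R) -> \bar R} :=
  mscale (NngNum (normr_ge0 a)) (pushforward lebesgue_measure g).
rewrite -[RHS]/(nu mg X); apply: lebesgue_measure_unique => // _ [[u v]] _ <-.
rewrite /nu/= /mscale /pushforward /=.
have [ap|an|ap0] := ltgtP a 0; last by rewrite ap0 eqxx in a0.
- rewrite [X in (_ * lebesgue_measure X)%E](_ : _ =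
      `[(v - b) / a, (u - b) / a[%classic); last first.
    apply/seteqP; split=> y /=; rewrite !in_itv/= /g.
      move=> /andP[? ?]; rewrite ler_ndivrMr// ltr_ndivlMr//.
      by apply/andP; split; lra.
    by rewrite ler_ndivrMr// ltr_ndivlMr// => /andP[h1 h2]; apply/andP; split; lra.
  rewrite !lebesgue_measure_itv/= !lte_fin ltr_nM2r ?invr_lt0// ltrD2r.
  case: ifPn => _; last by rewrite mule0.
  rewrite -!EFinD -EFinM; congr (_%:E).
  by rewrite ltr0_norm//; field.
- rewrite [X in (_ * lebesgue_measure X)%E](_ : _ =
      `](u - b) / a, (v - b) / a]%classic); last first.
    apply/seteqP; split=> y /=; rewrite !in_itv/= /g.
      move=> /andP[? ?]; rewrite ler_pdivlMr// ltr_pdivrMr//.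
      by apply/andP; split; lra.
    by rewrite ler_pdivlMr// ltr_pdivrMr// => /andP[h1 h2]; apply/andP; split; lra.
  rewrite !lebesgue_measure_itv/= !lte_fin ltr_pM2r ?invr_gt0// ltrD2r.
  case: ifPn => _; last by rewrite mule0.
  rewrite -!EFinD -EFinM; congr (_%:E).
  by rewrite gtr0_norm//; field.
Qed.

Definition affine2 {R : realType} (p q r s e f : R) (X : R * R) : R * R :=
  (p * X.1 + q * X.2 + e, r * X.1 + s * X.2 + f).

Lemma measurable_affine2 {R : realType} (p q r s e f : R) (X : set (R * R)) :
  measurable X -> measurable (affine2 p q r s e f @^-1` X).
Proof.
move=> mX; rewrite -[_ @^-1` _]setTI.
have m1 (a b c : R) : measurable_fun setT (fun X : R * R => a * X.1 + b * X.2 + c).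
  by apply: measurable_funD => //; apply: measurable_funD; apply: measurable_funM.
have m : measurable_fun setT (affine2 p q r s e f).
  exact: measurable_fun_pair.
exact: m.
Qed.

Lemma leb2_shear {R : realType} (r s f : R) (X : set (R * R)) :
  s != 0 -> measurable X ->
  (leb2 X = `|s|%:E * leb2 (affine2 1 0 r s 0 f @^-1` X))%E.
Proof.
move=> s0 mX; rewrite /product_measure1 /=.
rewrite -ge0_integralZl//=; last 1 first.
  by apply: measurable_fun_xsection; exact: measurable_affine2.
apply: eq_integral => x _ /=.
rewrite (lebesgue_measure_affine s (r * x + f))//; last exact: measurable_xsection.
congr (_ * lebesgue_measure _)%E.
rewrite /xsection /affine2; apply/seteqP; split=> y /=; rewrite !inE /=;
  by rewrite mul1r mul0r !addr0 addrCA (addrA (r * x)).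
Qed.

(** The pushforward under the swap agrees with the product measure on rectangles, which determine
    it. *)
Lemma leb2_swap {R : realType} (X : set (R * R)) :
  measurable X -> leb2 X = leb2 (affine2 0 1 1 0 0 0 @^-1` X).
Proof.
pose T := (measurableTypeR R * measurableTypeR R)%type.
pose g : T -> T := affine2 0 1 1 0 0 0.
have mg : measurable_fun setT g.
  by move=> _ Y mY; rewrite setTI; exact: measurable_affine2.
pose nu := (pushforward leb2 g) : {measure set T -> \bar R}.
move=> mX; rewrite -[RHS]/(nu mg X).
apply: product_measure_unique => // A B mA mB.
rewrite /nu/= /pushforward.
have -> : g @^-1` (A `*` B) = B `*` A.
  apply/seteqP; split=> -[x y]; rewrite /g /affine2 /= ?mul0r ?mul1r !add0r !addr0 =>
    -[] //.
by rewrite product_measure1E// muleC.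
Qed.

Lemma leb2_affine {R : realType} (p q r s e f : R) (X : set (R * R)) :
  p * s - q * r != 0 -> measurable X ->
  (leb2 X = `|p * s - q * r|%:E * leb2 (affine2 p q r s e f @^-1` X))%E.
Proof.
(* For s' <> 0 the map is a shear along y followed by a shear along x. *)
have main (p' q' r' s' e' f' : R) (Y : set (R * R)) :
    s' != 0 -> p' * s' - q' * r' != 0 -> measurable Y ->
    (leb2 Y =
     `|p' * s' - q' * r'|%:E * leb2 (affine2 p' q' r' s' e' f' @^-1` Y))%E.
  move=> s0 D0 mY.
  have a0 : (p' * s' - q' * r') / s' != 0 by rewrite mulf_neq0 ?invr_neq0.
  rewrite [LHS]leb2_swap//.
  (* Solving [v = r' x + s' y + f'] for [y] and substituting in [p' x + q' y + e'] gives these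
     coefficients of [v] and [1], and [(p' s' - q' r') / s'] for [x]. *)
  rewrite [LHS](leb2_shear (q' / s') _ (e' - q' * f' / s') _ a0);
    last exact: measurable_affine2.
  rewrite [X in (_ * X)%E]leb2_swap; last by do 2 apply: measurable_affine2.
  rewrite [X in (_ * X)%E](leb2_shear r' _ f' _ s0);
    last by do 3 apply: measurable_affine2.
  rewrite muleA -EFinM -normrM divfK//; congr (_ * leb2 _)%E.
  apply/funext => -[x y]; rewrite /preimage /affine2 /=.
  by congr (Y (_, _)); field.
move=> D0 mX; have [s0|s0] := eqVneq s 0; last exact: main.
(* For [s = 0], exchanging the rows puts [q] in the place of [s] and only changes the sign of the
   determinant. *)
have q0 : q != 0.
  by apply: contra_neq D0 => ->; rewrite s0; ring.
have D'0 : r * q - s * p != 0 by rewrite -oppr_eq0 opprB mulrC (mulrC r).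
rewrite leb2_swap// (main r s p q f e)//; last exact: measurable_affine2.
rewrite -normrN opprB (mulrC s) (mulrC r); congr (_ * leb2 _)%E.
apply/funext => -[x y]; rewrite /preimage /affine2 /=.
by congr (X (_, _)); ring.
Qed.

(** * Lines and half-planes *)

Lemma measurable_line {R : realType} (a b c : R) :
  measurable [set X : R * R | a * X.1 + b * X.2 + c = 0].
Proof.
have := measurable_affine2 a b 0 0 c 0 _
  (measurableX (measurable_set1 0) measurableT).
congr measurable; apply/seteqP; split=> X /=; first by case.
by [].
Qed.

(** Completing [(a, b)] by a second row to an invertible matrix makes the line a preimage of the
    null set [x = 0]. *)
Lemma leb2_line {R : realType} (a b c : R) : (a, b) != 0 ->
  leb2 [set X : R * R | a * X.1 + b * X.2 + c = 0] = 0%E.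
Proof.
have vert : leb2 ([set 0 : R] `*` [set: R]) = 0%E.
  transitivity (lebesgue_measure [set 0%R : R] * lebesgue_measure [set: R])%E.
    exact: product_measure1E.
  by rewrite lebesgue_measure_set1 mul0e.
have mV : measurable ([set 0 : R] `*` [set: R]) by exact: measurableX.
have null r s : a * s - b * r != 0 ->
    leb2 [set X : R * R | a * X.1 + b * X.2 + c = 0] = 0%E.
  move=> D0; move: vert; rewrite (leb2_affine a b r s c 0 _ D0 mV).
  move=> /eqP; rewrite mule_eq0 eqe normr_eq0 (negPf D0) /= => /eqP <-.
  congr leb2; apply/seteqP; split=> X /=; last by case.
  by [].
rewrite xpair_eqE negb_and => /orP[a0|b0].
  by apply: (null 0 1); rewrite mulr1 mulr0 subr0.
by apply: (null 1 0); rewrite mulr1 mulr0 sub0r oppr_eq0.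
Qed.


Lemma measurable_halfplane {R : realType} (a b c : R) :
  measurable [set X : R * R | 0 <= a * X.1 + b * X.2 + c].
Proof.
have := measurable_affine2 a b 0 0 c 0 _
  (measurableX (measurable_itv `[0, +oo[) measurableT).
congr measurable; apply/seteqP; split=> X /=; rewrite in_itv/= andbT.
  by case.
by [].
Qed.

Lemma leb2_setU_line {R : realType} (a b c : R) (S T : set (R * R)) :
  (a, b) != 0 -> measurable S -> measurable T -> (leb2 S < +oo)%E ->
  S `&` T `<=` [set X | a * X.1 + b * X.2 + c = 0] ->
  (leb2 (S `|` T) = leb2 S + leb2 T)%E.
Proof.
move=> ab0 mS mT Sfin ST.
have ST0 : leb2 (S `&` T) = 0%E.
  apply: (subset_measure0 _ _ _ (leb2_line a b c ab0)) => //.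
    exact: measurableI.
  exact: measurable_line.
transitivity (leb2 S + leb2 T - leb2 (S `&` T))%E; first exact: measureUfinl.
by rewrite ST0 sube0.
Qed.

(** * Area of triangles *)

Definition std_triangle (R : realType) : set (R * R) :=
  [set X | [/\ 0 <= X.1, 0 <= X.2 & X.1 + X.2 <= 1]].

Lemma measurable_std_triangle {R : realType} : measurable (std_triangle R).
Proof.
rewrite (_ : std_triangle R = [set X | 0 <= 1 * X.1 + 0 * X.2 + 0] `&`
    [set X | 0 <= 0 * X.1 + 1 * X.2 + 0] `&` [set X | 0 <= -1 * X.1 + -1 * X.2 + 1]).
  by apply: measurableI; [apply: measurableI|]; exact: measurable_halfplane.
apply/seteqP; split=> -[x y]; rewrite /std_triangle /=.
  by case=> ? ? ?; split; [split|]; lra.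
by case=> -[? ? ?]; split; lra.
Qed.

Lemma leb2_std_triangle {R : realType} : leb2 (std_triangle R) = (2^-1)%:E.
Proof.
(* [T'] is the reflection of [T] in the centre of the unit square; the two meet on [x + y = 1]. *)
pose T := std_triangle R; pose T' := affine2 (-1) 0 0 (-1) 1 1 @^-1` T.
have mT : measurable T := measurable_std_triangle.
have mT' : measurable T' by exact: measurable_affine2.
have TT' : leb2 T' = leb2 T.
  rewrite [RHS](leb2_affine (-1) 0 0 (-1) 1 1)//.
  by rewrite mulr0 subr0 mulrNN mulr1 normr1 mul1e.
have mI : measurable (`[0, 1]%classic : set R) by exact: measurable_itv.
have sq : leb2 (`[0, 1]%classic `*` `[0, 1]%classic : set (R * R)) = 1%E.
  transitivity (lebesgue_measure (`[0%R, 1%R]%classic : set R) *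
                lebesgue_measure (`[0%R, 1%R]%classic : set R))%E.
    exact: product_measure1E.
  by rewrite lebesgue_measure_itv/= lte_fin ltr01 oppr0 adde0 mule1.
have UE : T `|` T' = `[0, 1]%classic `*` `[0, 1]%classic.
  apply/seteqP; split=> -[x y]; rewrite /T' /T /std_triangle /affine2 /= !in_itv/=.
    by case=> -[? ? ?]; split; apply/andP; split; lra.
  move=> [/andP[? ?] /andP[? ?]]; have [?|?] := leP (x + y) 1.
    by left.
  by right; split; lra.
have Tfin : (leb2 T < +oo)%E.
  rewrite (@le_lt_trans _ _ 1%E) ?ltry// -sq -UE le_measure ?inE//.
  exact: measurableU.
move: sq; rewrite -UE (leb2_setU_line 1 1 (-1))//; last 2 first.
- by rewrite xpair_eqE oner_eq0.
- by move=> -[x y]; rewrite /T' /T /std_triangle /affine2 /= => -[[? ? ?] [? ? ?]]; lra.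
rewrite TT'.
have : leb2 T \is a fin_num by rewrite ge0_fin_numE.
rewrite -/T; case: (leb2 T) => // t _ [] h; congr (_%:E); lra.
Qed.

(** An intersection of half-planes, meant for [A], [B], [C] in counterclockwise order. *)
Definition triangle {R : realType} (A B C : R * R) : set (R * R) :=
  [set X | [/\ 0 <= det2 (B - A) (X - A), 0 <= det2 (C - B) (X - B)
             & 0 <= det2 (A - C) (X - C)]].

(** The affine map sends [X] to its barycentric weights at [B] and [C]. All three weights sum to 1,
    so [x + y <= 1] says that the weight at [A] is nonnegative. *)
Lemma triangle_affine {R : realType} (A B C : R * R) (d := det2 (B - A) (C - A)) :
  0 < d -> triangle A B C =
  affine2 ((C - A).2 / d) (- (C - A).1 / d) (- (B - A).2 / d) ((B - A).1 / d)
    (- det2 A (C - A) / d) (- det2 (B - A) A / d) @^-1` std_triangle R.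
Proof.
move=> d0.
have E X : affine2 ((C - A).2 / d) (- (C - A).1 / d) (- (B - A).2 / d) ((B - A).1 / d)
    (- det2 A (C - A) / d) (- det2 (B - A) A / d) X =
    (det2 (A - C) (X - C) / d, det2 (B - A) (X - A) / d).
  rewrite /affine2 /=; congr pair; rewrite /det2 /=; ring.
have dE X : d = det2 (B - A) (X - A) + det2 (C - B) (X - B) + det2 (A - C) (X - C).
  by rewrite /d /det2 /=; ring.
apply/seteqP; split=> X; rewrite /triangle /std_triangle /preimage /mkset E /=.
  move=> [h1 h2 h3]; split; rewrite ?divr_ge0 ?(ltW d0)//.
  by rewrite -mulrDl ler_pdivrMr// mul1r (dE X); lra.
rewrite !pmulr_lge0 ?invr_gt0// -mulrDl ler_pdivrMr// mul1r (dE X) => -[? ? ?].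
by split=> //; lra.
Qed.

Lemma measurable_triangle {R : realType} (A B C : R * R) :
  0 < det2 (B - A) (C - A) -> measurable (triangle A B C).
Proof.
move=> d0; rewrite triangle_affine//.
by apply: measurable_affine2; exact: measurable_std_triangle.
Qed.

Lemma leb2_triangle {R : realType} (A B C : R * R) :
  0 < det2 (B - A) (C - A) ->
  leb2 (triangle A B C) = (det2 (B - A) (C - A) / 2)%:E.
Proof.
set d := det2 _ _ => d0; have dn0 : d != 0 by rewrite gt_eqF.
have D : (C - A).2 / d * ((B - A).1 / d) - - (C - A).1 / d * (- (B - A).2 / d) = d^-1.
  transitivity (((B - A).1 * (C - A).2 - (B - A).2 * (C - A).1) / d / d); first by ring.
  by rewrite -[X in X / d / d]/d mulfV// mul1r.
have Dn0 : d^-1 != 0 by rewrite invr_eq0.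
move: (@leb2_std_triangle R).
rewrite (leb2_affine ((C - A).2 / d) (- (C - A).1 / d) (- (B - A).2 / d) ((B - A).1 / d)
    (- det2 A (C - A) / d) (- det2 (B - A) A / d)) ?D//;
  last exact: measurable_std_triangle.
rewrite -triangle_affine// gtr0_norm ?invr_gt0// => h.
by rewrite EFinM -h muleA -EFinM mulfV// mul1e.
Qed.

(** * Convex sets, and the quadrilateral as a union of two triangles *)

Lemma convex_setP {R : realType} (K : set (R * R)) :
  @convex_set R (R * R)%type K <->
  forall (t : R) (X Y : R * R), 0 <= t -> t <= 1 -> K X -> K Y ->
    K (t *: X + (1 - t) *: Y).
Proof.
split=> [cK t X Y t0 t1 KX KY|cK X Y t]; last first.
  by rewrite !inE => KX KY; exact: cK.
by have := cK X Y (Itv01 t0 t1); rewrite !inE; apply.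
Qed.

Lemma convex_halfplane {R : realType} (U V : R * R) :
  @convex_set R (R * R)%type [set X | 0 <= det2 U (X - V)].
Proof.
apply/convex_setP => t X Y t0 t1 /= hX hY.
have -> : det2 U (t *: X + (1 - t) *: Y - V) =
    t * det2 U (X - V) + (1 - t) * det2 U (Y - V).
  by rewrite /det2 /= /GRing.scale /=; ring.
by rewrite addr_ge0// mulr_ge0// subr_ge0.
Qed.

Lemma convex_setI {R : realType} (K L : set (R * R)) :
  @convex_set R (R * R)%type K -> @convex_set R (R * R)%type L ->
  @convex_set R (R * R)%type (K `&` L).
Proof.
move=> /convex_setP cK /convex_setP cL; apply/convex_setP.
by move=> t X Y t0 t1 [? ?] [? ?]; split; [exact: cK|exact: cL].
Qed.

(** A point of the triangle is a barycentric combination of the vertices. Convexity handles two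
    points at a time, so [A] and [B] are combined first, and the result with [C]. *)
Lemma triangle_sub_convex {R : realType} (A B C : R * R) (K : set (R * R)) :
  0 < det2 (B - A) (C - A) -> @convex_set R (R * R)%type K ->
  K A -> K B -> K C -> triangle A B C `<=` K.
Proof.
set d := det2 _ _ => d0 /convex_setP cK KA KB KC X [].
set c := det2 (B - A) _; set a := det2 (C - B) _; set b := det2 (A - C) _.
move=> c0 a0 b0.
have dE : d = a + b + c by rewrite /a /b /c /d /det2 /=; ring.
have XE : d *: X = a *: A + b *: B + c *: C.
  rewrite /a /b /c /d /det2 /GRing.scale /=.
  by congr pair; rewrite /= /GRing.scale /=; ring.
(* If the weights at [A] and [B] both vanish, then [X = C] and normalising by [a + b] is
   impossible. *)
have [ab0|ab0] := eqVneq (a + b) 0.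
  have az : a = 0 by lra.
  have bz : b = 0 by lra.
  have cd : c = d by lra.
  move: XE; rewrite az bz cd !scale0r !add0r => /scalerI -> //.
  by rewrite gt_eqF.
have ab1 : 0 < a + b by rewrite lt0r ab0 addr_ge0.
have -> : X = ((a + b) / d) *: ((a / (a + b)) *: A + (1 - a / (a + b)) *: B) +
    (1 - (a + b) / d) *: C.
  have dn0 : d != 0 by rewrite gt_eqF.
  apply: (scalerI dn0); rewrite XE !scalerDr !scalerA -/d.
  by congr (_ *: _ + _ *: _ + _ *: _); field: dE; rewrite ?dn0 ?ab0.
apply: (cK) => //; last apply: (cK) => //.
- by rewrite divr_ge0// ?ltW.
- by rewrite ler_pdivrMr// mul1r dE; lra.
- by rewrite divr_ge0// ?ltW.
- by rewrite ler_pdivrMr// mul1r; lra.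
Qed.

(** The hull lies in the four half-planes bounded by the sides, and the diagonal [AC] cuts their
    intersection into the two triangles. *)
Lemma quadrilateral_triangles {R : realType} (A B C D : R * R) :
  0 < det2 (B - A) (C - A) -> 0 < det2 (C - B) (D - B) ->
  0 < det2 (D - C) (A - C) -> 0 < det2 (A - D) (B - D) ->
  quadrilateral A B C D = triangle A B C `|` triangle A C D.
Proof.
move=> x0 y0 z0 w0.
have z0' : 0 < det2 (C - A) (D - A).
  by move: z0; rewrite /det2 /= => ?; lra.
apply/seteqP; split; last first.
  have cv (V : R * R) : [set A; B; C; D] V -> quadrilateral A B C D V.
    exact: sub_gen_smallest.
  have cvx : @convex_set R (R * R)%type (quadrilateral A B C D).
    apply/convex_setP => t X Y t0 t1 hX hY K [cK sK].
    have /convex_setP := cK; apply => //; [exact: hX|exact: hY].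
  have [hA hB hC hD] : [/\ quadrilateral A B C D A, quadrilateral A B C D B,
    quadrilateral A B C D C & quadrilateral A B C D D].
    by split; apply: cv; rewrite /=; tauto.
  by rewrite subUset; split; exact: triangle_sub_convex.
apply: (@subset_trans _ ([set X | 0 <= det2 (B - A) (X - A)] `&`
   [set X | 0 <= det2 (C - B) (X - B)] `&`
   [set X | 0 <= det2 (D - C) (X - C)] `&`
   [set X | 0 <= det2 (A - D) (X - D)])).
  apply: smallest_sub.
    by do 3 (apply: convex_setI; last exact: convex_halfplane); exact: convex_halfplane.
  move: x0 y0 z0 w0; rewrite /det2 /= => x0 y0 z0 w0.
  by move=> V /= [[[|]|]|] ->; (split; [split; [split|]|]); lra.
move=> X [[[h1 h2] h3] h4].
have [h|h] := leP 0 (det2 (A - C) (X - C)); [left|right]; split=> //.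
by move: h; rewrite /det2 /=; lra.
Qed.

(** * Area of a convex quadrilateral, and the ratio *)

Lemma leb2_quadrilateral {R : realType} (A B C D : R * R) :
  0 < det2 (B - A) (C - A) -> 0 < det2 (C - B) (D - B) ->
  0 < det2 (D - C) (A - C) -> 0 < det2 (A - D) (B - D) ->
  leb2 (quadrilateral A B C D) = (det2 (C - A) (D - B) / 2)%:E.
Proof.
move=> x0 y0 z0 w0; rewrite quadrilateral_triangles//.
have z0' : 0 < det2 (C - A) (D - A).
  by move: z0; rewrite /det2 /= => ?; lra.
(* These are the coefficients of [det2 (A - C) (X - C)], which vanishes on the line [AC]; the two
   triangles give it opposite signs. *)
rewrite (leb2_setU_line (C.2 - A.2) (A.1 - C.1) (C.1 * A.2 - A.1 * C.2)).
- rewrite !leb2_triangle// -EFinD; congr (_%:E).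
  by rewrite /det2 /=; lra.
- rewrite xpair_eqE !subr_eq0; apply/negP => /andP[/eqP e2 /eqP e1].
  by move: x0; rewrite /det2 /= e2 e1; lra.
- exact: measurable_triangle.
- exact: measurable_triangle.
- by rewrite leb2_triangle// ltry.
- by move=> X /= [[_ _ h1] [h2 _ _]]; move: h1 h2; rewrite /det2 /=; lra.
Qed.

Lemma area_quadrilateral {R : realType} (A B C D : R * R) :
  convex_quadrilateral A B C D ->
  area (quadrilateral A B C D) = `|det2 (C - A) (D - B)| / 2.
Proof.
have pos (A' B' C' D' : R * R) :
    [/\ 0 < det2 (B' - A') (C' - A'), 0 < det2 (C' - B') (D' - B'),
        0 < det2 (D' - C') (A' - C') & 0 < det2 (A' - D') (B' - D')] ->
    area (quadrilateral A' B' C' D') = `|det2 (C' - A') (D' - B')| / 2.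
  case=> x0 y0 z0 w0; rewrite /area leb2_quadrilateral//= gtr0_norm//.
  by move: x0 z0; rewrite /det2 /= => ? ?; lra.
move=> /convex_quadrilateralP[|[x0 y0 z0 w0]]; first exact: pos.
(* Reversing a clockwise order keeps the hull and makes all four determinants positive. *)
have -> : quadrilateral A B C D = quadrilateral A D C B.
  by congr convex_hull; apply/seteqP; split=> X /=; tauto.
rewrite pos; last first.
  by move: x0 y0 z0 w0; rewrite /det2 /= => *; split; lra.
by rewrite -(opprB D B) -normrN; congr (`|_| / 2); rewrite /det2 /=; ring.
Qed.

(** The determinant is the sum of the doubled signed areas of [ABC] and [CDA], which have the same
    sign. This allows the division in the ratio. *)
Lemma convex_quadrilateral_det_neq0 {R : realType} (A B C D : R * R) :
  convex_quadrilateral A B C D -> det2 (C - A) (D - B) != 0.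
Proof.
have -> : det2 (C - A) (D - B) = det2 (B - A) (C - A) + det2 (D - C) (A - C).
  by rewrite /det2 /=; ring.
by move=> /convex_quadrilateralP[[x0 _ z0 _]|[x0 _ z0 _]];
  apply/eqP => ?; lra.
Qed.

Theorem theorem3p1 (R : realType) (m : R) (A B C D M N P Q : R * R) :
  0 < m < 1 ->
  convex_quadrilateral A B C D ->
  divides_segment m A B M ->
  divides_segment m B C N ->
  divides_segment m C D P ->
  divides_segment m D A Q ->
  area (quadrilateral M N P Q) / area (quadrilateral A B C D)
    = 1 - 2 * m * (1 - m).
Proof.
move=> m01 K hM hN hP hQ.
rewrite !area_quadrilateral//; last exact: (kasner_convex m01 K hM hN hP hQ).
have -> : det2 (P - M) (Q - N) =
    (m ^+ 2 + (1 - m) ^+ 2) * det2 (C - A) (D - B).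
  move: hM hN hP hQ; rewrite /divides_segment.
  move=> /eqP; rewrite subr_eq => /eqP ->.
  move=> /eqP; rewrite subr_eq => /eqP ->.
  move=> /eqP; rewrite subr_eq => /eqP ->.
  move=> /eqP; rewrite subr_eq => /eqP ->.
  by rewrite /det2 /= /GRing.scale /=; ring.
have d0 := convex_quadrilateral_det_neq0 _ _ _ _ K.
(* The factor [m ^+ 2 + (1 - m) ^+ 2] is nonnegative, so it leaves the absolute value, and the area
   of [ABCD] cancels. *)
rewrite normrM ger0_norm ?addr_ge0 ?sqr_ge0// -(mulrA _ _ 2^-1) mulfK.
  by ring.
by rewrite mulf_neq0 ?normr_eq0// invr_eq0 pnatr_eq0.
Qed.
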